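(* An extension $\mathcal{L}$ of $\mathrm{BD}_\infty$ is truth-equational with defining equation $x\vee\neg x\approx x$ if and only if $\mathcal{L}$ validates the rules $\emptyset\vdash x\vee\neg x$ and $x,\ ((x\vee\neg x)\wedge y)\vee z\vdash(x\wedge y)\vee z$.
   Context: Formulas are built from variables using $\wedge,\vee,\neg$. A structure is a pair $\langle\mathbf{A},F\rangle$ with $\mathbf{A}$ an algebra of this signature and $F\subseteq A$; a rule $\Gamma\vdash\varphi$ is valid in it if every homomorphism $v$ from the formula algebra with $v[\Gamma]\subseteq F$ has $v(\varphi)\in F$; a model of a logic is a structure in which all its rules are valid. A logic is a substitution-invariant consequence relation. $\mathrm{BD}_\infty$ is the logic determined by all $\langle\mathbf{A},F\rangle$ with $\mathbf{A}$ a De~Morgan lattice (distributive lattice with $\neg$, $\neg\neg x=x$, De~Morgan laws) and $F$ an upset. The Leibniz congruence $\Omega^{\mathbf{A}}F$ is the largest congruence $\theta$ of $\mathbf{A}$ such that $a\in F$ and $\langle a,b\rangle\in\theta$ imply $b\in F$. $\mathcal{L}$ is truth-equational with defining equation $x\vee\neg x\approx x$ if for every model $\langle\mathbf{A},F\rangle$ of $\mathcal{L}$ and every $a\in A$: $a\in F$ iff $\langle a\vee\neg a,a\rangle\in\Omega^{\mathbf{A}}F$. *)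

(* Defs.v *)
From Stdlib Require Import Ensembles Image Relations.

Set Implicit Arguments.

Record algebra : Type := Algebra {
  carrier :> Type;
  meet : carrier -> carrier -> carrier;
  join : carrier -> carrier -> carrier;
  neg : carrier -> carrier }.

Arguments meet {a} _ _.
Arguments join {a} _ _.
Arguments neg {a} _.

Record is_hom (A B : algebra) (h : A -> B) : Prop := {
  hom_meet : forall a b : A, h (meet a b) = meet (h a) (h b);
  hom_join : forall a b : A, h (join a b) = join (h a) (h b);
  hom_neg : forall a : A, h (neg a) = neg (h a) }.

Record de_morgan_lattice (A : algebra) : Prop := {
  dm_meetA : forall a b c : A, meet a (meet b c) = meet (meet a b) c;
  dm_joinA : forall a b c : A, join a (join b c) = join (join a b) c;
  dm_meetC : forall a b : A, meet a b = meet b a;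
  dm_joinC : forall a b : A, join a b = join b a;
  dm_meetK : forall a b : A, meet a (join a b) = a;
  dm_joinK : forall a b : A, join a (meet a b) = a;
  dm_meetDr : forall a b c : A,
    meet a (join b c) = join (meet a b) (meet a c);
  dm_negK : forall a : A, neg (neg a) = a;
  dm_neg_meet : forall a b : A, neg (meet a b) = join (neg a) (neg b);
  dm_neg_join : forall a b : A, neg (join a b) = meet (neg a) (neg b) }.

(* The lattice order is [a <= b] iff [meet a b = a]. *)
Definition upset {A : algebra} (F : Ensemble A) : Prop :=
  forall a b : A, meet a b = a -> In A F a -> In A F b.

Inductive formula : Set :=
  | Var (n : nat)
  | And (p q : formula)
  | Or (p q : formula)
  | Not (p : formula).

Declare Scope formula_scope.
Delimit Scope formula_scope with fm.
Bind Scope formula_scope with formula.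
Notation "p ∧ q" := (And p q) (at level 40, left associativity) : formula_scope.
Notation "p ∨ q" := (Or p q) (at level 50, left associativity) : formula_scope.
Notation "¬ p" := (Not p) (at level 35, right associativity) : formula_scope.

Definition formula_algebra : algebra := Algebra And Or Not.

Record structure : Type := Structure {
  str_alg :> algebra;
  designated : Ensemble str_alg }.

Definition valid (M : structure) (Gamma : Ensemble formula) (phi : formula) :
    Prop :=
  forall v : formula -> M, @is_hom formula_algebra M v ->
    (forall gamma, In formula Gamma gamma -> In M (designated M) (v gamma)) ->
    In M (designated M) (v phi).

Record logic : Type := Logic {
  entails :> Ensemble formula -> formula -> Prop;
  entails_refl : forall Gamma phi, In formula Gamma phi -> entails Gamma phi;
  entails_mono : forall Gamma Delta phi,
    Included formula Gamma Delta -> entails Gamma phi -> entails Delta phi;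
  entails_cut : forall Gamma Delta phi,
    (forall delta, In formula Delta delta -> entails Gamma delta) ->
    entails Delta phi -> entails Gamma phi;
  entails_subst : forall (s : formula -> formula) Gamma phi,
    @is_hom formula_algebra formula_algebra s ->
    entails Gamma phi -> entails (Im formula formula Gamma s) (s phi) }.

Definition model (L : logic) (M : structure) : Prop :=
  forall Gamma phi, L Gamma phi -> valid M Gamma phi.

Definition extension (L0 L : logic) : Prop :=
  forall Gamma phi, L0 Gamma phi -> L Gamma phi.

Definition logic_of (K : structure -> Prop) : logic.
Proof.
refine (@Logic (fun Gamma phi => forall M, K M -> valid M Gamma phi) _ _ _ _).
- intros Gamma phi H M _ v _ Hv; exact (Hv _ H).
- intros Gamma Delta phi sub H M KM v hv Hv.
  exact (H M KM v hv (fun g Hg => Hv g (sub g Hg))).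
- intros Gamma Delta phi HD H M KM v hv Hv.
  exact (H M KM v hv (fun d Hd => HD d Hd M KM v hv Hv)).
- intros s Gamma phi [sm sj sn] H M KM v [vm vj vn] Hv.
  refine (H M KM (fun p => v (s p)) _ (fun g Hg => Hv _ _)).
  + split; simpl in *; intros; congruence.
  + exact (Im_intro _ _ _ s g Hg _ eq_refl).
Defined.

Definition BD_infty : logic :=
  logic_of (fun M => de_morgan_lattice M /\ upset (designated M)).

Record congruence {A : algebra} (theta : relation A) : Prop := {
  cong_equiv : equivalence A theta;
  cong_meet : forall a a' b b' : A,
    theta a a' -> theta b b' -> theta (meet a b) (meet a' b');
  cong_join : forall a a' b b' : A,
    theta a a' -> theta b b' -> theta (join a b) (join a' b');
  cong_neg : forall a a' : A, theta a a' -> theta (neg a) (neg a') }.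

Definition compatible {A : algebra} (F : Ensemble A) (theta : relation A) :
    Prop :=
  forall a b : A, In A F a -> theta a b -> In A F b.

(* The union of all compatible congruences; by [leibniz_largest] below it is
   itself a compatible congruence, hence the largest one. *)
Definition leibniz {A : algebra} (F : Ensemble A) : relation A :=
  fun a b => exists theta : relation A,
    congruence theta /\ compatible F theta /\ theta a b.

Lemma leibniz_largest (A : algebra) (F : Ensemble A) :
  congruence (leibniz F) /\ compatible F (leibniz F) /\
  (forall theta : relation A, congruence theta -> compatible F theta ->
     inclusion A theta (leibniz F)).
Proof.
set (T := clos_trans A (leibniz F)).
assert (refl : forall a, leibniz F a a).
{ intro a; exists eq; split; [split|split]; try congruence.
  split; unfold reflexive, symmetric, transitive; congruence. }
assert (sym : forall a b, leibniz F a b -> leibniz F b a).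
{ intros a b [t [ct [kt tab]]]; exists t; split; [|split]; auto; apply (equiv_sym _ _ (cong_equiv ct)), tab. }
assert (Fl : compatible F (leibniz F)).
{ intros a b Fa [t [ct [kt tab]]]; exact (kt a b Fa tab). }
assert (map : forall f : A -> A,
  (forall t, congruence t -> forall a b, t a b -> t (f a) (f b)) ->
  forall a b, T a b -> T (f a) (f b)).
{ intros f Hf a b H; induction H as [a b [t [ct [kt tab]]]|a b c _ IH1 _ IH2].
  - apply t_step; exists t; exact (conj ct (conj kt (Hf t ct a b tab))).
  - exact (t_trans _ _ _ _ _ IH1 IH2). }
assert (tref : forall (t : relation A), congruence t -> forall a, t a a).
{ intros t ct a; apply (equiv_refl _ _ (cong_equiv ct)). }
assert (cT : congruence T).
{ split.
  - split.
    + intro a; apply t_step, refl.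
    + intros a b c; apply t_trans.
    + intros a b H; induction H as [a b H|a b c _ IH1 _ IH2].
      * apply t_step, sym, H.
      * exact (t_trans _ _ _ _ _ IH2 IH1).
  - intros a a' b b' Ha Hb; apply t_trans with (meet a' b).
    + apply (map (fun x => meet x b)); [|exact Ha].
      intros t ct x y Hxy; exact (cong_meet ct _ _ _ _ Hxy (tref t ct b)).
    + apply (map (fun x => meet a' x)); [|exact Hb].
      intros t ct x y Hxy; exact (cong_meet ct _ _ _ _ (tref t ct a') Hxy).
  - intros a a' b b' Ha Hb; apply t_trans with (join a' b).
    + apply (map (fun x => join x b)); [|exact Ha].
      intros t ct x y Hxy; exact (cong_join ct _ _ _ _ Hxy (tref t ct b)).
    + apply (map (fun x => join a' x)); [|exact Hb].
      intros t ct x y Hxy; exact (cong_join ct _ _ _ _ (tref t ct a') Hxy).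
  - apply (map (fun x => neg x)).
    intros t ct x y Hxy; exact (cong_neg ct _ _ Hxy). }
assert (kT : compatible F T).
{ intros a b Fa H; revert Fa; induction H as [a b H|a b c _ IH1 _ IH2]; auto.
  intro Fa; exact (Fl a b Fa H). }
assert (TL : forall a b, T a b -> leibniz F a b).
{ intros a b H; exists T; auto. }
assert (LT : forall a b, leibniz F a b -> T a b).
{ intros a b H; apply t_step, H. }
destruct cT as [[r tr s] cm cj cn].
split; [split|split].
- split; [exact refl| |exact sym].
  intros a b c H1 H2; apply TL, (tr a b c); auto.
- intros; apply TL, cm; auto.
- intros; apply TL, cj; auto.
- intros; apply TL, cn; auto.
- exact Fl.
- intros t ct kt a b H; exists t; auto.
Qed.

(* Truth-equational with defining equation [x ∨ ¬x ≈ x]. *)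
Definition truth_equational (L : logic) : Prop :=
  forall M : structure, model L M ->
  forall a : M, In M (designated M) a <->
                leibniz (designated M) (join a (neg a)) a.

(* Main.v *)
(** For the forward direction, both rules are read off the Lindenbaum models
    [<Fm, Cn Gamma>]: a formula and any formula equal to it in De Morgan lattices
    are Leibniz congruent there, and [x ∨ ¬x] solves the defining equation.

    Conversely, in a model of [BD_infty] two elements [a], [b] are Leibniz
    congruent as soon as [(a ∧ y) ∨ z] and [(b ∧ y) ∨ z] are always designated
    together, and likewise for [¬a], [¬b]: by distributivity these contexts
    suffice to define a congruence.  For designated [a], the second rule makes
    [a] and [a ∨ ¬a] agree on the positive contexts; on the negative ones it is
    applied with [¬a ∧ y] in place of [y], because
    [¬a ∧ y = (a ∨ ¬a) ∧ (¬a ∧ y)] and [¬(a ∨ ¬a) ∧ y = a ∧ (¬a ∧ y)]. *)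

Require Import Defs.
From Stdlib Require Import Ensembles Image Relations.

Fixpoint eval {A : algebra} (v : nat -> A) (p : formula) : A :=
  match p with
  | Var n => v n
  | And p q => meet (eval v p) (eval v q)
  | Or p q => join (eval v p) (eval v q)
  | Not p => neg (eval v p)
  end.

Lemma eval_hom (A : algebra) (v : nat -> A) : @is_hom formula_algebra A (eval v).
Proof. split; reflexivity. Qed.

Lemma hom_eval (A : algebra) (h : formula -> A) (hh : @is_hom formula_algebra A h)
    (p : formula) : h p = eval (fun n => h (Var n)) p.
Proof.
destruct hh as [hm hj hn]; simpl in *.
induction p as [n|p IHp q IHq|p IHp q IHq|p IHp]; simpl;
  rewrite ?hm, ?hj, ?hn; congruence.
Qed.

Section DeMorganLattice.

Context {A : algebra} (dm : de_morgan_lattice A).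

Lemma dm_meetDl (a b c : A) : meet (join a b) c = join (meet a c) (meet b c).
Proof.
now rewrite (dm_meetC dm), (dm_meetDr dm), (dm_meetC dm c a), (dm_meetC dm c b).
Qed.

Lemma dm_meetCA (a b c : A) : meet a (meet b c) = meet b (meet a c).
Proof. now rewrite !(dm_meetA dm), (dm_meetC dm a b). Qed.

Lemma dm_joinCA (a b c : A) : join a (join b c) = join b (join a c).
Proof. now rewrite !(dm_joinA dm), (dm_joinC dm a b). Qed.

Lemma dm_neg_join_neg (a : A) : neg (join a (neg a)) = meet a (neg a).
Proof. now rewrite (dm_neg_join dm), (dm_negK dm), (dm_meetC dm). Qed.

End DeMorganLattice.

(** * Equality in De Morgan lattices and Lindenbaum models *)

Definition dm_equal (p q : formula) : Prop :=
  forall A : algebra, de_morgan_lattice A ->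
  forall v : nat -> A, eval v p = eval v q.

Lemma dm_equal_congruence : @congruence formula_algebra dm_equal.
Proof.
split; [split|..].
- intros p A dm v; reflexivity.
- intros p q r H1 H2 A dm v; rewrite H1, H2; trivial.
- intros p q H A dm v; symmetry; auto.
- intros p p' q q' H1 H2 A dm v; simpl; rewrite (H1 A dm), (H2 A dm); trivial.
- intros p p' q q' H1 H2 A dm v; simpl; rewrite (H1 A dm), (H2 A dm); trivial.
- intros p p' H A dm v; simpl; rewrite (H A dm); trivial.
Qed.

Lemma BD_infty_le (p q : formula) :
  (forall A : algebra, de_morgan_lattice A ->
   forall v : nat -> A, meet (eval v p) (eval v q) = eval v p) ->
  BD_infty (Singleton formula p) q.
Proof.
intros le M [dm up] v hv Hv.
apply (up (v p) (v q)); [|apply Hv; constructor].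
rewrite !(hom_eval _ _ hv); auto.
Qed.

Lemma BD_infty_equal (p q : formula) :
  dm_equal p q -> BD_infty (Singleton formula p) q.
Proof.
intro eq; apply BD_infty_le; intros A dm v; rewrite (eq A dm).
(* Idempotence of meet from the two absorption laws: the second factor [q] is expanded to
   [q ∨ (q ∧ q)]. *)
rewrite <- (dm_joinK dm (eval v q) (eval v q)) at 2; apply (dm_meetK dm).
Qed.

(** Valuations in the formula algebra are substitutions, so validity reduces to substitution
    invariance followed by cut. *)
Lemma Lindenbaum_model (L : logic) (Gamma : Ensemble formula) :
  model L (@Structure formula_algebra (L Gamma)).
Proof.
intros Delta phi H s hs Hs.
apply entails_cut with (Im formula formula Delta s).
- intros d [g Hg d' ->]; exact (Hs g Hg).
- exact (entails_subst L _ _ hs H).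
Qed.

Lemma Lindenbaum_leibniz (L : logic) (hL : extension BD_infty L)
    (Gamma : Ensemble formula) (p q : formula) :
  dm_equal p q -> @leibniz formula_algebra (L Gamma) p q.
Proof.
intro eq; exists dm_equal; split; [exact dm_equal_congruence|split; [|exact eq]].
intros r s Hr Hrs.
apply entails_cut with (Singleton formula r).
- intros d []; exact Hr.
- apply hL, BD_infty_equal, Hrs.
Qed.

(** The formulas evaluated at [env] use at most [Var 0] to [Var 3]; with fewer variables the last
    value is repeated. *)
Definition env {A : Type} (a b c d : A) (n : nat) : A :=
  match n with 0 => a | 1 => b | 2 => c | _ => d end.

(** * Context equivalence in models of [BD_infty] *)

Section Model.

Context (M : structure) (hM : model BD_infty M).

Local Notation F := (In M (designated M)).

Lemma designated_singleton (p q : formula) (v : nat -> M) :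
  BD_infty (Singleton formula p) q -> F (eval v p) -> F (eval v q).
Proof.
intros H Hp; apply (hM _ _ H _ (eval_hom M v)); intros g []; exact Hp.
Qed.

Lemma designated_le (p q r : formula) (v : nat -> M) :
  dm_equal q (Or p r) -> F (eval v p) -> F (eval v q).
Proof.
intro eq; apply designated_singleton, BD_infty_le.
intros A dm w; rewrite (eq A dm); apply (dm_meetK dm).
Qed.

(** The algebra of [M] need not be a De Morgan lattice, so lattice laws cannot be rewritten inside
    its terms. They are available only as equivalences between designations of whole formulas, which
    is the form of the lemmas that follow. *)
Lemma designated_equal (p q : formula) (v : nat -> M) :
  dm_equal p q -> F (eval v p) <-> F (eval v q).
Proof.
intro eq; split; apply designated_singleton, BD_infty_equal; trivial.
intros A dm w; symmetry; auto.
Qed.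

Local Notation x0 := (Var 0).
Local Notation x1 := (Var 1).
Local Notation x2 := (Var 2).
Local Notation x3 := (Var 3).

Lemma designated_meetA (a b y z : M) :
  F (join (meet (meet a b) y) z) <-> F (join (meet a (meet b y)) z).
Proof.
apply (designated_equal (((x0 ∧ x1) ∧ x2) ∨ x3)%fm ((x0 ∧ (x1 ∧ x2)) ∨ x3)%fm
  (env a b y z)).
intros A dm v; simpl; now rewrite (dm_meetA dm).
Qed.

Lemma designated_meetCA (a b y z : M) :
  F (join (meet a (meet b y)) z) <-> F (join (meet b (meet a y)) z).
Proof.
apply (designated_equal ((x0 ∧ (x1 ∧ x2)) ∨ x3)%fm ((x1 ∧ (x0 ∧ x2)) ∨ x3)%fm
  (env a b y z)).
intros A dm v; simpl; now rewrite (dm_meetCA dm).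
Qed.

Lemma designated_joinDl (a b y z : M) :
  F (join (meet (join a b) y) z) <-> F (join (meet a y) (join (meet b y) z)).
Proof.
apply (designated_equal (((x0 ∨ x1) ∧ x2) ∨ x3)%fm
  ((x0 ∧ x2) ∨ ((x1 ∧ x2) ∨ x3))%fm (env a b y z)).
intros A dm v; simpl; now rewrite (dm_meetDl dm), (dm_joinA dm).
Qed.

Lemma designated_joinCA (a b z : M) :
  F (join a (join b z)) <-> F (join b (join a z)).
Proof.
apply (designated_equal (x0 ∨ (x1 ∨ x2))%fm (x1 ∨ (x0 ∨ x2))%fm (env a b z z)).
intros A dm v; simpl; now rewrite (dm_joinCA dm).
Qed.

Lemma designated_neg_meet (a b y z : M) :
  F (join (meet (neg (meet a b)) y) z) <->
  F (join (meet (join (neg a) (neg b)) y) z).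
Proof.
apply (designated_equal ((¬ (x0 ∧ x1) ∧ x2) ∨ x3)%fm
  (((¬ x0 ∨ ¬ x1) ∧ x2) ∨ x3)%fm (env a b y z)).
intros A dm v; simpl; now rewrite (dm_neg_meet dm).
Qed.

Lemma designated_neg_join (a b y z : M) :
  F (join (meet (neg (join a b)) y) z) <->
  F (join (meet (meet (neg a) (neg b)) y) z).
Proof.
apply (designated_equal ((¬ (x0 ∨ x1) ∧ x2) ∨ x3)%fm
  (((¬ x0 ∧ ¬ x1) ∧ x2) ∨ x3)%fm (env a b y z)).
intros A dm v; simpl; now rewrite (dm_neg_join dm).
Qed.

Lemma designated_negK (a y z : M) :
  F (join (meet (neg (neg a)) y) z) <-> F (join (meet a y) z).
Proof.
apply (designated_equal ((¬ ¬ x0 ∧ x1) ∨ x2)%fm ((x0 ∧ x1) ∨ x2)%fm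
  (env a y z z)).
intros A dm v; simpl; now rewrite (dm_negK dm).
Qed.

Definition same_contexts (a b : M) : Prop :=
  forall y z : M, F (join (meet a y) z) <-> F (join (meet b y) z).

Definition context_rel (a b : M) : Prop :=
  same_contexts a b /\ same_contexts (neg a) (neg b).

(** The factor not being replaced is absorbed into the parameter [y]; commuting the factors lets
    each be replaced in turn. *)
Lemma same_contexts_meet (a a' b b' : M) :
  same_contexts a a' -> same_contexts b b' ->
  same_contexts (meet a b) (meet a' b').
Proof.
intros Ha Hb y z.
now rewrite !designated_meetA, (Ha (meet b y)), designated_meetCA,
  (Hb (meet a' y)), designated_meetCA.
Qed.

(** Distributivity moves the other summand, met with [y], into the parameter [z]. *)
Lemma same_contexts_join (a a' b b' : M) :
  same_contexts a a' -> same_contexts b b' ->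
  same_contexts (join a b) (join a' b').
Proof.
intros Ha Hb y z.
now rewrite !designated_joinDl, (Ha y), designated_joinCA, (Hb y),
  designated_joinCA.
Qed.

Lemma context_rel_congruence : congruence context_rel.
Proof.
split; [split|..].
- split; intros y z; reflexivity.
- intros a b c [H1 H2] [H3 H4]; split; intros y z.
  + now rewrite (H1 y z).
  + now rewrite (H2 y z).
- intros a b [H1 H2]; split; intros y z; symmetry; auto.
- intros a a' b b' [H1 H2] [H3 H4]; split.
  + now apply same_contexts_meet.
  + intros y z; rewrite !designated_neg_meet; now apply same_contexts_join.
- intros a a' b b' [H1 H2] [H3 H4]; split.
  + now apply same_contexts_join.
  + intros y z; rewrite !designated_neg_join; now apply same_contexts_meet.
- intros a a' [H1 H2]; split; [trivial|].
  intros y z; rewrite !designated_negK; apply H1.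
Qed.

(* Without a top element, [a] itself is recovered from its contexts as
   [(a ∧ (a ∨ b)) ∨ (a ∧ b)], which becomes [b] when the first [a] is replaced. *)
Lemma context_rel_compatible : compatible (designated M) context_rel.
Proof.
intros a b Ha [H _].
apply (designated_equal ((x1 ∧ (x0 ∨ x1)) ∨ (x0 ∧ x1))%fm x1 (env a b b b)).
{ intros A dm v; simpl.
  now rewrite (dm_joinC dm (v 0)), (dm_meetC dm (v 0)), (dm_meetK dm),
    (dm_joinK dm). }
apply (H (join a b) (meet a b)).
apply (designated_equal ((x0 ∧ (x0 ∨ x1)) ∨ (x0 ∧ x1))%fm x0 (env a b b b));
  [|exact Ha].
intros A dm v; simpl; now rewrite (dm_meetK dm), (dm_joinK dm).
Qed.

(** Two of the four implications are monotonicity, from [a <= a ∨ ¬a] and [¬(a ∨ ¬a) <= ¬a]; the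
    other two use the hypothesis. *)
Lemma context_rel_excluded_middle (a : M) :
  (forall y z : M, F (join (meet (join a (neg a)) y) z) ->
                   F (join (meet a y) z)) ->
  context_rel (join a (neg a)) a.
Proof.
intro H; split; intros y z; split.
- apply H.
- apply (designated_le ((x0 ∧ x1) ∨ x2)%fm (((x0 ∨ ¬ x0) ∧ x1) ∨ x2)%fm
    (¬ x0 ∧ x1)%fm (env a y z z)).
  intros A dm v; simpl.
  now rewrite (dm_meetDl dm), <- !(dm_joinA dm),
    (dm_joinC dm _ (v 2)).
(* Joining with [¬a ∧ y] absorbs [(a ∧ ¬a) ∧ y]. *)
- apply (designated_le ((¬ (x0 ∨ ¬ x0) ∧ x1) ∨ x2)%fm ((¬ x0 ∧ x1) ∨ x2)%fm
    (¬ x0 ∧ x1)%fm (env a y z z)).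
  intros A dm v; simpl.
  rewrite (dm_neg_join_neg dm), <- (dm_meetA dm), (dm_joinC dm (join _ _)),
    (dm_joinA dm), (dm_meetC dm (v 0)), (dm_joinK dm); reflexivity.
- intro Hy.
  apply (designated_equal ((x0 ∧ (¬ x0 ∧ x1)) ∨ x2)%fm
    ((¬ (x0 ∨ ¬ x0) ∧ x1) ∨ x2)%fm (env a y z z)).
  { intros A dm v; simpl; now rewrite (dm_neg_join_neg dm), (dm_meetA dm). }
  apply (H (meet (neg a) y) z).
  apply (designated_equal ((¬ x0 ∧ x1) ∨ x2)%fm
    (((x0 ∨ ¬ x0) ∧ (¬ x0 ∧ x1)) ∨ x2)%fm (env a y z z)); [|exact Hy].
  intros A dm v; simpl.
  now rewrite (dm_meetA dm (join _ _)), (dm_meetC dm (join _ _)),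
    (dm_joinC dm (v 0)), (dm_meetK dm).
Qed.

End Model.

Theorem mainTheorem17 (L : logic) (hL : extension BD_infty L) :
  truth_equational L <->
  (let x := Var 0 in let y := Var 1 in let z := Var 2 in
   L (Empty_set formula) (x ∨ ¬ x)%fm /\
   L (Couple formula x (((x ∨ ¬ x) ∧ y) ∨ z)%fm) ((x ∧ y) ∨ z)%fm).
Proof.
split.
- intros te x y z; split.
  + apply (te _ (Lindenbaum_model L (Empty_set formula)) (x ∨ ¬ x)%fm).
    apply Lindenbaum_leibniz; [exact hL|].
    intros A dm v; simpl.
    now rewrite (dm_neg_join_neg dm), <- (dm_joinA dm), (dm_meetC dm (v 0)),
      (dm_joinK dm).
  + set (Gamma := Couple formula x (((x ∨ ¬ x) ∧ y) ∨ z)%fm).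
    assert (Hx : @leibniz formula_algebra (L Gamma) (x ∨ ¬ x)%fm x).
    { apply (te _ (Lindenbaum_model L Gamma) x).
      apply entails_refl; constructor. }
    destruct (@leibniz_largest formula_algebra (L Gamma))
      as [[[r _ _] cm cj _] [compat _]].
    (* The second premise and the conclusion differ only by the congruent pair [x ∨ ¬x], [x]. *)
    apply (compat (((x ∨ ¬ x) ∧ y) ∨ z)%fm).
    * apply entails_refl; constructor.
    * apply (cj _ _ z z); [|apply r].
      apply (cm _ _ y y); [exact Hx|apply r].
- intros [em rule] M hM a.
  assert (hBD : model BD_infty M) by (intros Gamma phi H; apply hM, hL, H).
  split.
  + intro Ha; exists (context_rel M); split; [|split].
    * now apply context_rel_congruence.
    * now apply context_rel_compatible.
    * apply context_rel_excluded_middle; [exact hBD|].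
      intros y z Hyz.
      apply (hM _ _ rule _ (eval_hom M (env a y z z))).
      intros g []; assumption.
  (* The first rule designates [a ∨ ¬a], and compatibility carries this to [a]. *)
  + intros [theta [cong [compat H]]].
    apply (compat (join a (neg a))); [|exact H].
    apply (hM _ _ em _ (eval_hom M (fun _ => a))).
    intros g [].
Qed.
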